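(* An arbitrary symmetric operator $A$ in a complex Hilbert space $X$ is not hypercyclic.
   Context: A symmetric operator is a (bounded or unbounded) densely defined linear operator $A$ with $A\subseteq A^*$, where $A^*$ is the adjoint of $A$. Hypercyclicity: for a (bounded or unbounded) linear operator $A$ with domain $D(A)$ in a (real or complex) Banach space $X$, let $C^\infty(A):=\bigcap_{n=0}^\infty D(A^n)$, where $A^0:=I$ is the identity operator on $X$. A nonzero vector $f\in C^\infty(A)$ is called hypercyclic for $A$ if its orbit $\{A^nf\}_{n\in\mathbb{Z}_+}$, $\mathbb{Z}_+:=\{0,1,2,\dots\}$, is dense in $X$. The operator $A$ is called hypercyclic if it possesses a hypercyclic vector. *)

(* Defs.v *)
From HB Require Import structures.
From mathcomp Require Import all_boot all_order all_algebra.
From mathcomp Require Import all_classical all_reals all_analysis.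
From mathcomp Require Import complex.

Set Implicit Arguments.
Unset Strict Implicit.
Unset Printing Implicit Defensive.

Import Order.TTheory GRing.Theory Num.Theory.
Import numFieldNormedType.Exports.

Local Open Scope classical_set_scope.
Local Open Scope ring_scope.

(* A partially defined map in X with domain [dom A]. The values of [A] outside
   [dom A] are meaningless and are not used below. *)
Record operator (X : Type) := Operator { dom : set X; opfun :> X -> X }.

Definition sub_operator (X : Type) (A B : operator X) : Prop :=
  dom A `<=` dom B /\ (forall x, dom A x -> A x = B x).

Definition id_operator (X : Type) : operator X := Operator setT idfun.

Definition comp_operator (X : Type) (A B : operator X) : operator X :=
  Operator [set x | dom B x /\ dom A (B x)] (A \o B).

Definition exp_operator (X : Type) (A : operator X) (n : nat) : operator X :=
  iter n (comp_operator A) (id_operator X).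

Definition linear_operator (K : numFieldType) (X : lmodType K)
    (A : operator X) : Prop :=
  [/\ dom A 0,
      forall (a : K) x y, dom A x -> dom A y -> dom A (a *: x + y) &
      forall (a : K) x y, dom A x -> dom A y -> A (a *: x + y) = a *: A x + A y].

Definition Cinfty (X : Type) (A : operator X) : set X :=
  \bigcap_(n in [set: nat]) dom (exp_operator A n).

Definition op_orbit (X : Type) (A : operator X) (f : X) : set X :=
  range (fun n : nat => exp_operator A n f).

Definition hypercyclic_vector (K : numFieldType) (X : normedModType K)
    (A : operator X) (f : X) : Prop :=
  [/\ f != 0, Cinfty A f & dense (op_orbit A f)].

Definition hypercyclic (K : numFieldType) (X : normedModType K)
    (A : operator X) : Prop :=
  exists f : X, hypercyclic_vector A f.

(* Together with the completeness of X, this makes (X, ip) a Hilbert space.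
   [ip] is linear in its first argument, conjugate-linear in its second. *)
Definition induces_norm (R : realType) (X : normedModType R[i])
    (ip : {dot X for Num.conj}) : Prop :=
  forall x : X, `|x| ^+ 2 = ip x x.

(* [z] is a value of the adjoint of [A] at [y]; it is the only one if [dom A] is
   dense. *)
Definition adjoint_rel (R : realType) (X : normedModType R[i])
    (ip : {dot X for Num.conj}) (A : operator X) (y z : X) : Prop :=
  forall x, dom A x -> ip (A x) y = ip x z.

Definition adjoint (R : realType) (X : normedModType R[i])
    (ip : {dot X for Num.conj}) (A : operator X) : operator X :=
  Operator [set y | exists z, adjoint_rel ip A y z]
           (fun y => xget 0 [set z | adjoint_rel ip A y z]).

Definition symmetric_operator (R : realType) (X : normedModType R[i])
    (ip : {dot X for Num.conj}) (A : operator X) : Prop :=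
  [/\ linear_operator A, dense (dom A) & sub_operator A (adjoint ip A)].

(* Main.v *)
(** The squared norms of the orbit are convex: by symmetry
    [<f_n, f_(n+2)> = <f_(n+2), f_n> = |f_(n+1)|^2], so expanding
    [0 <= |f_n - f_(n+2)|^2] gives [2 |f_(n+1)|^2 <= |f_n|^2 + |f_(n+2)|^2].
    Hence the norms either never increase, and the orbit is bounded, or they
    increase at some step and never decrease afterwards; then no [f_n] vanishes
    and the orbit is bounded away from [0]. *)
Require Import Defs.
From mathcomp Require Import all_boot all_order all_algebra.
From mathcomp Require Import all_classical all_reals all_analysis.
From mathcomp Require Import complex.
Local Open Scope ring_scope.
Import Order.TTheory GRing.Theory Num.Theory.
Import numFieldNormedType.Exports.
Local Open Scope classical_set_scope.

(** [xget] falls back to [0] only on an empty set, which membership in the domain of the adjoint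
    excludes. *)
Lemma adjoint_relP {R : realType} {X : normedModType R[i]}
    {ip : {dot X for Num.conj}} {A : operator X} {y : X} :
  dom (adjoint ip A) y -> adjoint_rel ip A y (adjoint ip A y).
Proof. by move=> [z zP]; apply: (@xgetI _ 0 _ z). Qed.

Lemma symmetric_ip {R : realType} {X : normedModType R[i]}
    {ip : {dot X for Num.conj}} {A : operator X} :
  symmetric_operator ip A ->
  forall x y, dom A x -> dom A y -> ip (A x) y = ip x (A y).
Proof.
move=> [_ _ [domA eqA]] x y Ax Ay.
by rewrite (eqA y Ay); apply: (adjoint_relP (domA y Ay)).
Qed.

Lemma symmetric_norm_convex {R : realType} {X : normedModType R[i]}
    {ip : {dot X for Num.conj}} {A : operator X} :
  induces_norm ip -> symmetric_operator ip A ->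
  forall x, dom A x -> dom A (A x) ->
  `|A x| ^+ 2 *+ 2 <= `|x| ^+ 2 + `|A (A x)| ^+ 2.
Proof.
move=> ip_norm A_sym x Ax AAx.
have : 0 <= `|x - A (A x)| ^+ 2 by rewrite exprn_ge0.
rewrite !ip_norm linearBl /= !linearBr /=.
(* Moving one [A] across turns both cross terms into [ip (A x) (A x)]. *)
rewrite -(symmetric_ip A_sym x (A x)) // (symmetric_ip A_sym (A x) x) //.
by rewrite opprB addrACA -opprD -mulr2n subr_ge0.
Qed.

Lemma linear_operator0 {K : numFieldType} {X : lmodType K} {A : operator X} :
  linear_operator A -> A 0 = 0.
Proof.
move=> [A0 _ /(_ (-1) 0 0 A0 A0)].
by rewrite scaler0 addr0 scaleN1r addNr.
Qed.

Lemma dense_norm_near {K : numFieldType} {X : normedModType K} {S : set X} :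
  dense S -> forall (x : X) (e : K), 0 < e -> exists2 y, S y & `|x - y| < e.
Proof.
move=> dS x e e0.
have [||y [xy Sy]] := dS (ball x e).
- by exists x; apply: ballxx.
- exact: ball_open.
- by exists y => //; move: xy; rewrite -ball_normE.
Qed.

(** The open ball of radius the norm of [f] about [f *+ 2] misses the closed ball of that radius
    about [0]. *)
Lemma dense_norm_unbounded {K : numFieldType} {X : normedModType K} {S : set X}
    {f : X} :
  f != 0 -> dense S -> ~ (forall y, S y -> `|y| <= `|f|).
Proof.
move=> f0 dS bS.
have [|y Sy] := dense_norm_near dS (f *+ 2) `|f|; first by rewrite normr_gt0.
apply/negP; rewrite -real_leNgt ?normr_real//.
apply: le_trans (lerB_normD _ _).
by rewrite normrN normrMn mulr2n lerBrDr lerD2l bS.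
Qed.

(** The order of [K] is only partial; a running minimum works because positive elements are real,
    hence comparable. *)
Lemma pos_lower_bound {K : numFieldType} (u : nat -> K) (n : nat) :
  (forall k, (k <= n)%N -> 0 < u k) ->
  exists2 c, 0 < c & forall k, (k <= n)%N -> c <= u k.
Proof.
elim: n => [|n IH] u0.
  by exists (u 0); [exact: u0|move=> k; rewrite leqn0 => /eqP ->].
have [k kn|c c0 cu] := IH; first exact/u0/leqW.
have un0 := u0 n.+1 (leqnn _).
have cuR : (c >=< u n.+1)%O by rewrite real_comparable ?gtr0_real.
exists (Order.min c (u n.+1)); first by rewrite comparable_lt_min ?c0.
move=> k; rewrite leq_eqVlt comparable_ge_min// => /predU1P[->|/cu ->//].
by rewrite lexx orbT.
Qed.

Theorem theorem4p1 (R : realType) (X : completeNormedModType R[i])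
    (ip : {dot X for Num.conj}) (ip_norm : induces_norm ip)
    (A : operator X) (A_sym : symmetric_operator ip A) :
  ~ hypercyclic A.
Proof.
move=> [f [f0 fC dorb]].
pose u n := exp_operator A n f.
have uS n : u n.+1 = A (u n) by [].
have uD n : dom A (u n) by have [] := fC n.+1 I.
have A0 : A 0 = 0 by case: A_sym => /linear_operator0.
have u_mono n : `|u n| <= `|u n.+1| -> `|u n.+1| <= `|u n.+2|.
  move=> le_n; rewrite -(@ler_pXn2r _ 2)// ?nnegrE//.
  (* Adding the middle square to both sides makes the left side that of the convexity inequality. *)
  rewrite -(lerD2l (`|u n.+1| ^+ 2)) -mulr2n.
  apply: le_trans (symmetric_norm_convex ip_norm A_sym (u n) (uD n) (uD n.+1)) _.
  by rewrite lerD2r ler_pXn2r ?nnegrE.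
have [decr|] := pselect (forall n, `|u n.+1| <= `|u n|).
  apply: (dense_norm_unbounded f0 dorb) => _ [n _ <-].
  by elim: n => // n; apply: le_trans (decr n).
move=> /existsNP[n /negP]; rewrite -real_ltNge ?normr_real// => lt_n.
have u_ge k : `|u n| <= `|u (n + k)%N| /\ `|u (n + k)%N| <= `|u (n + k).+1|.
  elim: k => [|k [le1 le2]]; first by rewrite addn0 lexx ltW.
  by rewrite addnS (le_trans le1 le2) u_mono.
have un0 : u n != 0.
  by apply: contraTneq lt_n => un0; rewrite uS un0 A0 ltxx.
(* Since [A 0 = 0], a zero at index [k] would propagate up to [u n]. *)
have u_neq0 k : (k <= n)%N -> 0 < `|u k|.
  move=> kn; rewrite normr_gt0; apply: contra_neq un0 => uk0.
  rewrite -(subnKC kn); elim: (n - k)%N => [|m IH]; first by rewrite addn0.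
  by rewrite addnS uS IH A0.
(* [c] bounds the norms up to index [n] from below; later norms are at least that of [u n], so the
   orbit avoids the open ball of radius [c] about [0]. *)
have [c c0 cu] := pos_lower_bound (fun k => `|u k|) n u_neq0.
have [_ [k _ <-]] := dense_norm_near dorb 0 c c0.
apply/negP; rewrite sub0r normrN -real_leNgt ?normr_real ?gtr0_real//.
have [/cu//|/ltnW/subnKC <-] := leqP k n.
exact: le_trans (cu n (leqnn n)) (proj1 (u_ge _)).
Qed.
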